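(* (i) Let $x:T^n=\mathbb{R}^n/\Lambda_n\to\mathbb{S}^{2N-1}$ be a homogeneous isometric immersion, where $T^n$ carries the metric $\frac{4\pi^2}{n}(du_1^2+\dots+du_n^2)$ and $2N$ is the number of vectors of length $1$ in the dual lattice $\Lambda_n^*$. Let $Q$ be the Gram matrix of $\Lambda_n^*$ with respect to a chosen basis $\eta_1,\dots,\eta_n$ of $\Lambda_n^*$, and let $Y\subset\mathbb{Z}^n$ be the set of coordinate vectors, with respect to this basis, of the vectors of $\Lambda_n^*$ of length $1$ (one chosen from each pair $\pm\xi$). If $x$ is minimal, then $Q$ is a critical point of the determinant function restricted to $W_Y$. (ii) Conversely, let $X\subset\mathbb{Z}^n$ be a set of integer vectors. If $Q$ is a critical point of the determinant function restricted to $W_X$ and $\frac1nQ^{-1}$ lies in the convex hull $C_X$, then the flat torus $\mathbb{R}^n/\Lambda_n$, where $\Lambda_n$ is a lattice with Gram matrix $Q^{-1}$, equipped with the metric $\frac{4\pi^2}{n}(du_1^2+\dots+du_n^2)$, admits an isometric minimal immersion in $\mathbb{S}^{2N-1}$, where $2N$ is the number of $v\in\mathbb{Z}^n$ with $vQv^t=1$.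
   Context: $S(n)$ is the space of real symmetric $n\times n$ matrices and $\Sigma_+\subset S(n)$ the open cone of positive definite matrices. Vectors in $\mathbb{Z}^n$ are row vectors. For $X\subset\mathbb{Z}^n$: $C_X\subset S(n)$ is the convex hull of $\{A^tA: A\in X\}$, and $W_X=\{M\in\Sigma_+: AMA^t=1\ \text{for all }A\in X\}$ (an open subset of an affine subspace of $S(n)$). The dual lattice is $\Lambda_n^*=\{\xi:\langle\xi,v\rangle\in\mathbb{Z}\ \forall v\in\Lambda_n\}$. An immersion $x$ of $\mathbb{R}^n/\Lambda_n$ into a sphere is called homogeneous here if, up to an orthogonal transformation, it has the form $x(u)=(c_1e^{2\pi i\langle\xi_1,u\rangle},\dots,c_Ne^{2\pi i\langle\xi_N,u\rangle})$ with $\xi_j\in\Lambda_n^*$ and $c_j\geq 0$. (When $x$ is also minimal and isometric for the metric $\frac{4\pi^2}{n}(du_1^2+\dots+du_n^2)$ on $\mathbb{R}^n/\Lambda_n$, where $u=(u_1,\dots,u_n)$ are the standard coordinates of $\mathbb{R}^n$, the vectors $\xi_1,\dots,\xi_N$ can be taken to be all vectors of length $1$ of $\Lambda_n^*$ up to sign, with some $c_j$ possibly zero.) *)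

(* Defs.v *)
From HB Require Import structures.
From mathcomp Require Import all_boot all_order all_algebra.
From mathcomp Require Import all_classical all_reals all_analysis.

Set Implicit Arguments.
Unset Strict Implicit.
Unset Printing Implicit Defensive.

Import Order.TTheory GRing.Theory Num.Theory.
Import numFieldNormedType.Exports.

Local Open Scope classical_set_scope.
Local Open Scope ring_scope.

Definition dot (R : realType) (m : nat) (u v : 'rV[R]_m) : R :=
  (u *m v^T) 0 0.

(* The library norm on ['rV[R]_m] is the sup norm, hence a separate one. *)
Definition enorm (R : realType) (m : nat) (u : 'rV[R]_m) : R :=
  Num.sqrt (dot u u).

Definition intv (R : realType) (n : nat) (A : 'rV[int]_n) : 'rV[R]_n :=
  map_mx intr A.

Definition qform (R : realType) (n : nat) (M : 'M[R]_n) (v : 'rV[R]_n) : R :=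
  (v *m M *m v^T) 0 0.

(** Lattices of full rank in R^n; a basis is given by the rows of a matrix. *)

Definition lattice_basis (R : realType) (n : nat)
    (L : set 'rV[R]_n) (B : 'M[R]_n) : Prop :=
  B \in unitmx /\ L = range (fun z : 'rV[int]_n => intv R z *m B).

Definition is_lattice (R : realType) (n : nat) (L : set 'rV[R]_n) : Prop :=
  exists B : 'M[R]_n, lattice_basis L B.

Definition dual_lattice (R : realType) (n : nat) (L : set 'rV[R]_n) :
    set 'rV[R]_n :=
  [set xi | forall v, L v -> exists k : int, dot xi v = k%:~R].

Definition gram (R : realType) (n : nat) (B : 'M[R]_n) : 'M[R]_n := B *m B^T.

Definition unit_vectors (R : realType) (n : nat) (L : set 'rV[R]_n) :
    set 'rV[R]_n :=
  [set xi | L xi /\ enorm xi = 1].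

(* [Y] consists of the coordinates, in the basis [E], of exactly one vector
   from each pair of opposite vectors of length 1 of the lattice [L]. *)
Definition half_unit_coords (R : realType) (n : nat) (L : set 'rV[R]_n)
    (E : 'M[R]_n) (Y : set 'rV[int]_n) : Prop :=
  (forall A, Y A -> unit_vectors L (intv R A *m E)) /\
  (forall A, unit_vectors L (intv R A *m E) ->
     (Y A /\ ~ Y (- A)) \/ (~ Y A /\ Y (- A))).

(** The cone of positive definite matrices, W_X and C_X. *)

Definition posdef (R : realType) (n : nat) : set 'M[R]_n :=
  [set M | M^T = M /\ forall v : 'rV[R]_n, v != 0 -> 0 < qform M v].

Definition W_of (R : realType) (n : nat) (X : set 'rV[int]_n) : set 'M[R]_n :=
  [set M | posdef M /\ forall A, X A -> qform M (intv R A) = 1].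

Definition convex_hull (R : realType) (V : lmodType R) (S : set V) : set V :=
  [set v | exists (m : nat) (w : 'I_m -> R) (p : 'I_m -> V),
     [/\ forall i, S (p i), forall i, 0 <= w i, \sum_i w i = 1 &
         v = \sum_i w i *: p i]].

Definition C_of (R : realType) (n : nat) (X : set 'rV[int]_n) : set 'M[R]_n :=
  convex_hull [set (intv R A)^T *m intv R A | A in X].

(* Critical point of the restriction of [f] to a set [S] that is relatively
   open in an affine subspace: the tangent space of [S] at [Q] then consists of
   the [H] with [Q + t H] in [S] for all small [t]. *)
Definition critical_on (R : realType) (V : normedModType R) (f : V -> R)
    (S : set V) (Q : V) : Prop :=
  S Q /\
  forall H : V, (\forall t \near (0 : R), S (Q + t *: H)) -> is_derive Q H f 0.

(** Immersions of flat tori into spheres. *)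

Fixpoint Ck (R : realType) (V W : normedModType R) (k : nat) (f : V -> W) :
    Prop :=
  match k with
  | 0%N => continuous f
  | k'.+1 => (forall u, differentiable f u) /\ forall v, Ck k' ('D_v f)
  end.

Definition smooth (R : realType) (V W : normedModType R) (f : V -> W) : Prop :=
  forall k, Ck k f.

Definition partial (R : realType) (n m : nat) (i : 'I_n)
    (x : 'rV[R]_n -> 'rV[R]_m) : 'rV[R]_n -> 'rV[R]_m :=
  'D_(delta_mx 0 i) x.

(* Maps from R^n/L are given by L-periodic maps on R^n. *)
Definition torus_sphere_immersion (R : realType) (n m : nat)
    (L : set 'rV[R]_n) (x : 'rV[R]_n -> 'rV[R]_m) : Prop :=
  [/\ forall u v, L v -> x (u + v) = x u,
      forall u, enorm (x u) = 1,
      smooth x &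
      forall u, injective ('d x u)].

Definition first_fundamental_form (R : realType) (n m : nat)
    (x : 'rV[R]_n -> 'rV[R]_m) (u : 'rV[R]_n) : 'M[R]_n :=
  \matrix_(i, j) dot (partial i x u) (partial j x u).

(* Isometric for the metric (4 pi^2 / n) (du_1^2 + ... + du_n^2). *)
Definition isometric (R : realType) (n m : nat)
    (x : 'rV[R]_n -> 'rV[R]_m) : Prop :=
  forall u, first_fundamental_form x u = (4%:R * pi ^+ 2 / n%:R)%:M.

(* Normal vectors at [x u] of the immersion [x], inside the tangent space of
   the unit sphere. *)
Definition sphere_normal (R : realType) (n m : nat)
    (x : 'rV[R]_n -> 'rV[R]_m) (u : 'rV[R]_n) : set 'rV[R]_m :=
  [set nu | dot (x u) nu = 0 /\ forall i, dot (partial i x u) nu = 0].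

(* For [nu] in [sphere_normal x u], the second fundamental form of [x] in the
   sphere, in the direction [nu], has coefficients <d_i d_j x, nu>: the
   Levi-Civita connection of the sphere is the tangential part of the flat one.
   Its trace is taken with respect to the induced metric. *)
Definition mean_curvature (R : realType) (n m : nat)
    (x : 'rV[R]_n -> 'rV[R]_m) (u : 'rV[R]_n) (nu : 'rV[R]_m) : R :=
  \sum_i \sum_j
    invmx (first_fundamental_form x u) i j * dot (partial i (partial j x) u) nu.

Definition minimal_in_sphere (R : realType) (n m : nat)
    (x : 'rV[R]_n -> 'rV[R]_m) : Prop :=
  forall u nu, sphere_normal x u nu -> mean_curvature x u nu = 0.

(* u |-> (c_1 e^{2 pi i <xi_1, u>}, ..., c_N e^{2 pi i <xi_N, u>}), where C^N is
   identified with R^{N+N} by z |-> (Re z, Im z). *)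
Definition exp_map (R : realType) (n N : nat) (c : 'I_N -> R)
    (xi : 'I_N -> 'rV[R]_n) (u : 'rV[R]_n) : 'rV[R]_(N + N) :=
  row_mx (\row_j (c j * cos (2%:R * pi * dot (xi j) u)))
         (\row_j (c j * sin (2%:R * pi * dot (xi j) u))).

Definition homogeneous (R : realType) (n N : nat) (L : set 'rV[R]_n)
    (x : 'rV[R]_n -> 'rV[R]_(N + N)) : Prop :=
  exists (O : 'M[R]_(N + N)) (c : 'I_N -> R) (xi : 'I_N -> 'rV[R]_n),
    [/\ O *m O^T = 1%:M,
        forall j, 0 <= c j,
        forall j, dual_lattice L (xi j) &
        forall u, x u = exp_map c xi u *m O].

(* Main.v *)
Require Import Defs.
From HB Require Import structures.
From mathcomp Require Import all_boot all_order all_algebra.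
From mathcomp Require Import all_classical all_reals all_analysis.
From mathcomp Require Import ring lra zify.
Import Order.TTheory GRing.Theory Num.Theory.
Import numFieldNormedType.Exports.
Local Open Scope classical_set_scope.
Local Open Scope ring_scope.
Local Open Scope card_scope.

Set Implicit Arguments.
Unset Strict Implicit.
Unset Printing Implicit Defensive.

(** A homogeneous map is a superposition of plane waves
    [c_j exp (2 pi i <xi_j, u>)], up to an orthogonal matrix; differentiating it
    only changes the complex amplitudes, and inner products of two such maps
    depend on the amplitudes alone.  Hence it is isometric exactly when
    [sum_j c_j^2 xi_j^t xi_j = 1/n], and on the normal space its mean curvature
    is, up to a scalar, the Laplacian, which multiplies the j-th amplitude by
    [- 4 pi^2 |xi_j|^2].  Minimality then means [|xi_j| = 1] whenever [c_j <> 0].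
    In coordinates, [sum_j c_j^2 A_j^t A_j = Q^-1 / n], which turns the
    differential [det Q * tr (Q^-1 H)] of the determinant into a combination of
    the [A_j H A_j^t], all zero for [H] tangent to [W_Y].  Conversely, an
    expression of [Q^-1 / n] as a convex combination of the [A^t A] provides the
    amplitudes of a minimal isometric immersion. *)

(** * Euclidean inner product and quadratic forms *)

Section DotProduct.
Variables (R : realType) (n : nat).
Implicit Types u v w : 'rV[R]_n.

Lemma dotE u v : dot u v = \sum_i u 0 i * v 0 i.
Proof. by rewrite /dot !mxE; apply: eq_bigr => i _; rewrite !mxE. Qed.

Lemma dotC u v : dot u v = dot v u.
Proof. by rewrite !dotE; apply: eq_bigr => i _; rewrite mulrC. Qed.

Lemma dotDr u v w : dot u (v + w) = dot u v + dot u w.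
Proof. by rewrite /dot linearD /= mulmxDr mxE. Qed.

Lemma dotZr k u v : dot u (k *: v) = k * dot u v.
Proof. by rewrite /dot linearZ /= -scalemxAr mxE. Qed.

Lemma dotZl k u v : dot (k *: u) v = k * dot u v.
Proof. by rewrite dotC dotZr dotC. Qed.

Lemma dot_delta u i : dot u (delta_mx 0 i) = u 0 i.
Proof.
rewrite dotE (bigD1 i) //= big1 => [|j ji].
  by rewrite !mxE !eqxx mulr1 addr0.
by rewrite !mxE (negPf ji) andbF mulr0.
Qed.

Lemma dot_ge0 u : 0 <= dot u u.
Proof. by rewrite dotE sumr_ge0 // => i _; rewrite -expr2 sqr_ge0. Qed.

Lemma dot_eq0 u : (dot u u == 0) = (u == 0).
Proof.
apply/idP/eqP => [|->]; last by rewrite dotE big1 // => i _; rewrite mxE mul0r.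
rewrite dotE psumr_eq0 => [/allP u0|i _]; last by rewrite -expr2 sqr_ge0.
apply/rowP => i; have := u0 i (mem_index_enum _).
by rewrite mulf_eq0 orbb !mxE => /eqP.
Qed.

Lemma enorm1P u : enorm u = 1 <-> dot u u = 1.
Proof.
split=> [u1|u1]; last by rewrite /enorm u1 sqrtr1.
by rewrite -(sqr_sqrtr (dot_ge0 u)) -/(enorm u) u1 expr1n.
Qed.

Lemma dot_mulmx m (O : 'M[R]_(n, m)) u v :
  O *m O^T = 1%:M -> dot (u *m O) (v *m O) = dot u v.
Proof. by move=> OO; rewrite /dot trmx_mul mulmxA -(mulmxA u) OO mulmx1. Qed.

Lemma dot_gram (E : 'M[R]_n) u : dot (u *m E) (u *m E) = qform (gram E) u.
Proof. by rewrite /dot /qform /gram trmx_mul !mulmxA. Qed.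

Lemma qform_mxtrace (M : 'M[R]_n) u : qform M u = \tr (u^T *m u *m M).
Proof. by rewrite -mulmxA mxtrace_mulC /mxtrace big_ord1. Qed.

Lemma qform_outer (u v : 'rV[R]_n) : qform (u^T *m u) v = dot u v ^+ 2.
Proof.
rewrite /qform mulmxA -mulmxA mxE big_ord1 expr2 -/(dot u v).
by rewrite -/(dot v u) dotC.
Qed.

Lemma qform_sum I (s : seq I) (k : I -> R) (M : I -> 'M[R]_n) u :
  qform (\sum_(i <- s) k i *: M i) u = \sum_(i <- s) k i * qform (M i) u.
Proof.
rewrite /qform mulmx_sumr mulmx_suml summxE; apply: eq_bigr => i _.
by rewrite -scalemxAr -scalemxAl mxE.
Qed.

End DotProduct.

(** * Differentials of vector-valued sums *)

Lemma is_diffZl (R : numFieldType) (V W : normedModType R)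
    (k dk : V -> R) (w : W) (x : V) :
  is_diff x k dk -> is_diff x (fun z => k z *: w) (fun z => dk z *: w).
Proof.
case=> kd kE; apply: DiffDef; first exact: differentiableZl.
by rewrite diffZl // kE.
Qed.

Lemma is_diff_sum (R : numFieldType) (V W : normedModType R) m
    (f df : 'I_m -> V -> W) (x : V) :
  (forall i, is_diff x (f i) (df i)) ->
  is_diff x (\sum_i f i) (\sum_i df i).
Proof.
move=> fd; elim/big_ind2: _ => [|? ? ? ? ? ?|//].
  exact: is_diff_cst.
exact: is_diffD.
Qed.

(** * Superpositions of plane waves and their derivatives *)

Section Waves.
Variables (R : realType) (n N : nat).
Implicit Types (O : 'M[R]_(N + N)) (xi : 'I_N -> 'rV[R]_n) (a b c : 'I_N -> R).
Implicit Types (u v : 'rV[R]_n).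

Definition phase (x u : 'rV[R]_n) : R := 2%:R * pi * dot x u.

(* In complex notation, the j-th component is [(a j + i b j) exp (i phase)]. *)
Definition wave O xi a b u : 'rV[R]_(N + N) :=
  row_mx (\row_j (a j * cos (phase (xi j) u) - b j * sin (phase (xi j) u)))
         (\row_j (a j * sin (phase (xi j) u) + b j * cos (phase (xi j) u)))
  *m O.

Lemma phaseD x u v : phase x (u + v) = phase x u + phase x v.
Proof. by rewrite /phase dotDr mulrDr. Qed.

Lemma is_diff_phase (x u : 'rV[R]_n) : is_diff u (phase x) (phase x).
Proof.
have lin : linear (phase x : 'rV[R]_n -> R^o).
  by move=> k v w; rewrite phaseD /phase dotZr mulrCA.
pose linM := GRing.isLinear.Build _ _ _ _ _ lin.
pose f : {linear 'rV[R]_n -> R^o} := HB.pack (phase x : 'rV[R]_n -> R^o) linM.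
(* A continuous linear map is its own differential; continuity comes from expanding the phase in
   coordinate functions. *)
have cf : continuous f.
  move=> w; apply: differentiable_continuous.
  have -> : (f : 'rV[R]_n -> R^o) =
      \sum_i (fun u : 'rV[R]_n => u 0 i *: (2%:R * pi * x 0 i : R^o)).
    apply/funext => z; rewrite /= fct_sumE /phase dotE mulr_sumr.
    by apply: eq_bigr => i _; rewrite /GRing.scale /= mulrA mulrC.
  apply: differentiable_sum => i.
  exact/differentiableZl/differentiable_coord.
apply: DiffDef; first exact: (@linear_differentiable _ _ _ f).
exact: (@diff_lin _ _ _ f).
Qed.

Lemma is_diff_comp_phase (f : R -> R) (x u : 'rV[R]_n) df :
  is_derive (phase x u) 1 f df ->
  is_diff u (fun u => f (phase x u)) (fun v => phase x v * df).
Proof.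
move=> fd; have d1 : derivable f (phase x u) 1 by case: fd.
have D : is_diff (phase x u) f (fun h => h *: df).
  apply: DiffDef; first exact/derivable1_diffP.
  by rewrite deriv1E // derive1E; case: fd => _ ->.
by have := is_diff_comp (is_diff_phase x u) D.
Qed.

Lemma is_diff_trig (p q : R) (x u : 'rV[R]_n) :
  is_diff u (fun u => p * cos (phase x u) + q * sin (phase x u))
    (fun v => phase x v * (q * cos (phase x u) - p * sin (phase x u))).
Proof.
have := is_diff_comp_phase (f := fun t => p * cos t + q * sin t)
  (x := x) (u := u) (df := q * cos (phase x u) - p * sin (phase x u)).
apply; set t := phase x u.
have H : is_derive t 1 (p \*: cos + q \*: sin) (p *: - sin t + q *: cos t).
  by apply: is_deriveD.
apply: is_derive_eq H _.
by rewrite /GRing.scale /=; ring.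
Qed.

(** Separates scalar functions of [u] from the constant rows of [O], so that the differential can be
    taken term by term. *)
Lemma wave_sumE O xi a b :
  wave O xi a b = \sum_j
   ((fun u => (a j * cos (phase (xi j) u) + - b j * sin (phase (xi j) u))
        *: row (lshift N j) O) +
    (fun u => (b j * cos (phase (xi j) u) + a j * sin (phase (xi j) u))
        *: row (rshift N j) O)).
Proof.
apply/funext => u; rewrite fct_sumE /wave mulmx_sum_row big_split_ord /=.
rewrite -big_split; apply: eq_bigr => j _; rewrite /= row_mxEl row_mxEr !mxE.
by rewrite !fctE mulNr [b j * _ + _]addrC.
Qed.

(** Differentiating along [v] multiplies the j-th complex amplitude by [i phase (xi j) v], which
    sends [(a, b)] to [(- phase b, phase a)]. *)
Lemma wave_is_diff O xi a b u :
  is_diff u (wave O xi a b) (fun v =>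
    wave O xi (fun j => - (phase (xi j) v * b j))
              (fun j => phase (xi j) v * a j) u).
Proof.
have H j : is_diff u
   ((fun u => (a j * cos (phase (xi j) u) + - b j * sin (phase (xi j) u))
        *: row (lshift N j) O) +
    (fun u => (b j * cos (phase (xi j) u) + a j * sin (phase (xi j) u))
        *: row (rshift N j) O)) _ :=
  is_diffD
    (is_diffZl (row (lshift N j) O) (is_diff_trig (a j) (- b j) (xi j) u))
    (is_diffZl (row (rshift N j) O) (is_diff_trig (b j) (a j) (xi j) u)).
rewrite wave_sumE; apply: is_diff_eq (is_diff_sum H) _.
apply/funext => v; rewrite wave_sumE !fct_sumE; apply: eq_bigr => j _.
rewrite !fctE; congr (_ *: _ + _ *: _); ring.
Qed.

Lemma derive_wave O xi a b v :
  'D_v (wave O xi a b) =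
  wave O xi (fun j => - (phase (xi j) v * b j)) (fun j => phase (xi j) v * a j).
Proof.
apply/funext => u; have [d dE] := wave_is_diff O xi a b u.
by rewrite deriveE // dE.
Qed.

Lemma differentiable_wave O xi a b u : differentiable (wave O xi a b) u.
Proof. by case: (wave_is_diff O xi a b u). Qed.

Lemma smooth_wave O xi a b : smooth (wave O xi a b).
Proof.
move=> k; elim: k a b => [|k IHk] a b /=.
  by move=> u; apply/differentiable_continuous/differentiable_wave.
by split=> [u|v]; [exact: differentiable_wave | rewrite derive_wave].
Qed.

Lemma exp_map_wave O xi c u : exp_map c xi u *m O = wave O xi c (fun=> 0) u.
Proof.
by congr (row_mx _ _ *m _); apply/rowP => j; rewrite !mxE mul0r ?subr0 ?addr0.
Qed.

Lemma wave_sum I (s : seq I) O xi (a b : I -> 'I_N -> R) u :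
  \sum_(i <- s) wave O xi (a i) (b i) u =
  wave O xi (fun j => \sum_(i <- s) a i j) (fun j => \sum_(i <- s) b i j) u.
Proof.
rewrite -mulmx_suml; congr (_ *m _); apply/rowP => k; rewrite summxE !mxE.
under eq_bigr do rewrite mxE.
case: (fintype.split k) => j.
  rewrite mxE; under eq_bigr do rewrite mxE.
  by rewrite sumrB !mulr_suml.
rewrite mxE; under eq_bigr do rewrite mxE.
by rewrite big_split !mulr_suml.
Qed.

(** At a given [u], both waves are rotated by the same phase in each complex coordinate, and [O] is
    orthogonal; only the amplitudes remain. *)
Lemma dot_wave O xi a b a' b' u : O *m O^T = 1%:M ->
  dot (wave O xi a b u) (wave O xi a' b' u) = \sum_j (a j * a' j + b j * b' j).
Proof.
move=> OO; rewrite dot_mulmx // dotE big_split_ord /= -big_split /=.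
apply: eq_bigr => j _; rewrite !row_mxEl !row_mxEr !mxE.
set t := phase _ _; have := cos2Dsin2 t; set C := cos t; set S := sin t => CS.
transitivity ((a j * a' j + b j * b' j) * (C ^+ 2 + S ^+ 2)); first by ring.
by rewrite CS mulr1.
Qed.

Lemma partial_wave O xi a b i :
  partial i (wave O xi a b) =
  wave O xi (fun j => - (2%:R * pi * xi j 0 i * b j))
            (fun j => 2%:R * pi * xi j 0 i * a j).
Proof.
rewrite /partial derive_wave /phase; under eq_fun do rewrite dot_delta.
by under [X in wave _ _ _ X]eq_fun do rewrite dot_delta.
Qed.

(** Up to the factor [4 pi^2], the metric induced by the map with amplitudes [c] and frequencies
    [xi]. *)
Definition second_moment c xi : 'M[R]_n :=
  \sum_j c j ^+ 2 *: ((xi j)^T *m xi j).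

Lemma mxtrace_second_moment c xi :
  \tr (second_moment c xi) = \sum_j c j ^+ 2 * dot (xi j) (xi j).
Proof.
rewrite /second_moment raddf_sum; apply: eq_bigr => j _ /=.
by rewrite mxtraceZ mxtrace_mulC /mxtrace big_ord1.
Qed.

(** * Metric, mean curvature and minimality of a wave map *)

Section Frame.
Variables (O : 'M[R]_(N + N)) (xi : 'I_N -> 'rV[R]_n) (c : 'I_N -> R).
Hypothesis OO : O *m O^T = 1%:M.
Let x := wave O xi c (fun=> 0).

Lemma first_fundamental_form_wave u :
  first_fundamental_form x u = (4%:R * pi ^+ 2) *: second_moment c xi.
Proof.
apply/matrixP => i k; rewrite !mxE summxE /x !partial_wave dot_wave //.
rewrite mulr_sumr; apply: eq_bigr => j _; rewrite !mxE big_ord1 !mxE.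
by ring.
Qed.

Lemma dot_wave_self u : dot (x u) (x u) = \sum_j c j ^+ 2.
Proof. by rewrite dot_wave //; apply: eq_bigr => j _; rewrite mulr0 addr0. Qed.

Hypothesis n_gt0 : (0 < n)%N.

Let n_neq0 : (n%:R : R) != 0. Proof. by rewrite pnatr_eq0 -lt0n. Qed.

Let k_neq0 : (4%:R * pi ^+ 2 : R) != 0.
Proof. by rewrite mulf_neq0 ?expf_neq0 ?pnatr_eq0 // gt_eqF ?pi_gt0. Qed.

Lemma isometric_waveP : isometric x <-> second_moment c xi = (n%:R^-1)%:M.
Proof.
split=> [/(_ 0)|sm u]; rewrite first_fundamental_form_wave.
  by rewrite -scale_scalar_mx => /(scalerI k_neq0).
by rewrite sm scale_scalar_mx.
Qed.

(** The metric is scalar, so the trace is [n / (4 pi^2)] times the Laplacian, which multiplies the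
    j-th amplitude by [- 4 pi^2 |xi_j|^2]. *)
Lemma mean_curvature_wave u nu : isometric x ->
  mean_curvature x u nu =
  - n%:R * dot (wave O xi (fun j => dot (xi j) (xi j) * c j) (fun=> 0) u) nu.
Proof.
move=> iso; rewrite /mean_curvature iso.
have -> : invmx (4%:R * pi ^+ 2 / n%:R)%:M =
    (n%:R / (4%:R * pi ^+ 2))%:M :> 'M[R]_n.
  by rewrite invmx_scalar invf_div.
transitivity
  (\sum_i n%:R / (4%:R * pi ^+ 2) * dot (partial i (partial i x) u) nu).
  apply: eq_bigr => i _; rewrite (bigD1 i) //= big1 ?addr0 => [|j ji].
    by rewrite !mxE eqxx mulr1n.
  by rewrite !mxE eq_sym (negPf ji) mul0r.
rewrite -mulr_sumr.
have -> : \sum_i dot (partial i (partial i x) u) nu =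
    dot (\sum_i partial i (partial i x) u) nu.
  by rewrite /dot mulmx_suml summxE.
under [X in dot X]eq_bigr do rewrite /x !partial_wave.
rewrite wave_sum.
have -> : wave O xi
    (fun j => \sum_i - (2%:R * pi * xi j 0 i * (2%:R * pi * xi j 0 i * c j)))
    (fun j => \sum_i 2%:R * pi * xi j 0 i * - (2%:R * pi * xi j 0 i * 0)) u =
  - (4%:R * pi ^+ 2) *:
    wave O xi (fun j => dot (xi j) (xi j) * c j) (fun=> 0) u.
  have Hre j : \sum_i - (2%:R * pi * xi j 0 i * (2%:R * pi * xi j 0 i * c j)) =
      - (4%:R * pi ^+ 2) * (dot (xi j) (xi j) * c j).
    by rewrite dotE mulr_suml mulr_sumr; apply: eq_bigr => i _; ring.
  have Him j :
      \sum_i 2%:R * pi * xi j 0 i * - (2%:R * pi * xi j 0 i * 0) = 0 :> R.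
    by rewrite big1 // => i _; ring.
  rewrite scalemxAl; congr (_ *m _); rewrite scale_row_mx.
  by congr row_mx; apply/rowP => j; rewrite !mxE Hre Him; ring.
by rewrite dotZl mulrA mulrN mulrVK // unitfE.
Qed.

(* The normal vector used is a multiple of the Laplacian of [x] plus [4 pi^2 x]. *)
Lemma minimal_wave_unit : (forall u, enorm (x u) = 1) -> isometric x ->
  minimal_in_sphere x -> forall j, c j != 0 -> dot (xi j) (xi j) = 1.
Proof.
move=> x1 iso xmin j cj0.
pose d j := dot (xi j) (xi j).
pose nu := wave O xi (fun j => (d j - 1) * c j) (fun=> 0) 0.
have c1 : \sum_j c j ^+ 2 = 1 by rewrite -(dot_wave_self 0); apply/enorm1P.
(* The trace of the isometry condition: the identity divided by [n] has trace 1. *)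
have cd1 : \sum_j c j ^+ 2 * d j = 1.
  rewrite -mxtrace_second_moment (isometric_waveP.1 iso) mxtrace_scalar.
  by rewrite -[_ *+ n]mulr_natr mulVf.
have xnu : dot (x 0) nu = 0.
  transitivity (\sum_j c j ^+ 2 * d j - \sum_j c j ^+ 2).
    rewrite dot_wave // -sumrB; apply: eq_bigr => i _; ring.
  by rewrite cd1 c1 subrr.
have nor : sphere_normal x 0 nu.
  (* The amplitudes of the partial derivatives are purely imaginary, those of [nu] real. *)
  split=> // i; rewrite /x partial_wave dot_wave // big1 // => k _; ring.
have /eqP := xmin 0 nu nor.
rewrite mean_curvature_wave // mulf_eq0 oppr_eq0 (negPf n_neq0) /= => /eqP lnu.
(* [nu] is the difference of two vectors, both now known to be orthogonal to [nu]. *)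
have : dot nu nu = 0.
  transitivity
    (dot (wave O xi (fun j => d j * c j) (fun=> 0) 0) nu - dot (x 0) nu).
    by rewrite !dot_wave // -sumrB; apply: eq_bigr => i _; ring.
  by rewrite lnu xnu subrr.
rewrite dot_wave // => /eqP.
rewrite psumr_eq0 => [/allP/(_ j (mem_index_enum _)) /=|i _].
  rewrite mulr0 addr0 mulf_eq0 orbb mulf_eq0 (negPf cj0) orbF subr_eq0.
  by move=> /eqP.
by rewrite mulr0 addr0 -expr2 sqr_ge0.
Qed.

(** With unit frequencies the Laplacian is a multiple of [x] itself, to which normal vectors are
    orthogonal. *)
Lemma minimal_wave : isometric x -> (forall j, dot (xi j) (xi j) = 1) ->
  minimal_in_sphere x.
Proof.
move=> iso xi1 u nu [xnu _]; rewrite mean_curvature_wave //.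
under eq_fun do rewrite xi1 mul1r.
by rewrite xnu mulr0.
Qed.

(** The differential at [z] has squared norm [4 pi^2] times the second moment form at [z], that is
    [4 pi^2 |z|^2 / n]. *)
Lemma injective_diff_wave u : isometric x -> injective ('d x u).
Proof.
move=> iso v w vw; apply/eqP; rewrite -subr_eq0; set z := v - w.
have : wave O xi (fun j => - (phase (xi j) z * 0))
                 (fun j => phase (xi j) z * c j) u = 0.
  have [_ /(congr1 (fun f => f z)) /= <-] := wave_is_diff O xi c (fun=> 0) u.
  by rewrite -/x linearB /= vw subrr.
move=> /(congr1 (fun y => dot y y)) /=.
rewrite [RHS]dotE big1 => [|i _]; last first.
  by rewrite mxE mul0r.
rewrite dot_wave // => z0; rewrite -dot_eq0; apply/eqP.
have : qform (second_moment c xi) z = 0.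
  apply: (mulfI k_neq0); rewrite mulr0 -z0 qform_sum mulr_sumr.
  by apply: eq_bigr => j _; rewrite qform_outer /phase; ring.
rewrite (isometric_waveP.1 iso) /qform mul_mx_scalar -scalemxAl mxE -/(dot z z).
by move=> /eqP; rewrite mulf_eq0 invr_eq0 (negPf n_neq0) => /eqP.
Qed.

End Frame.

Lemma wave_periodic O xi a b (L : set 'rV[R]_n) u v :
  (forall j, dual_lattice L (xi j)) -> L v ->
  wave O xi a b (u + v) = wave O xi a b u.
Proof.
move=> xiL Lv.
have cs j : cos (phase (xi j) (u + v)) = cos (phase (xi j) u) /\
            sin (phase (xi j) (u + v)) = sin (phase (xi j) u).
  have [k kE] := xiL j v Lv; rewrite phaseD /phase kE; move: (_ * dot _ u) => t.
  have -> : 2%:R * pi * k%:~R = (pi *+ 2) *~ k :> R by rewrite mulrzr mulr_natl.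
  case: k {kE} => k.
    by rewrite -pmulrn (periodicn (@cosD2pi R)) (periodicn (@sinD2pi R)).
  (* For a negative multiple, [k.+1] periods are added back. *)
  rewrite NegzE mulrNz -pmulrn.
  split.
    by rewrite -(periodicn (@cosD2pi R) k.+1) subrK.
  by rewrite -(periodicn (@sinD2pi R) k.+1) subrK.
by congr (row_mx _ _ *m _); apply/rowP => j; rewrite !mxE; have [-> ->] := cs j.
Qed.

Lemma second_moment_mulmx c (A : 'I_N -> 'rV[R]_n) (E : 'M[R]_n) :
  second_moment c (fun j => A j *m E) = E^T *m second_moment c A *m E.
Proof.
rewrite mulmx_sumr mulmx_suml; apply: eq_bigr => j _.
by rewrite -scalemxAr -scalemxAl trmx_mul !mulmxA.
Qed.

End Waves.

(** * Jacobi's formula for the derivative of the determinant *)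

Section Jacobi.
Variables (R : realType) (n : nat).
Implicit Types Q H M : 'M[R]_n.

Lemma horner_char_poly M (t : R) : (char_poly M).[t] = \det (t%:M - M).
Proof.
rewrite -[LHS]/(horner_eval t _) -det_map_mx; congr (\det _).
apply/matrixP => i j; rewrite !mxE /= /horner_eval.
by rewrite hornerD hornerN hornerMn hornerX hornerC.
Qed.

(* The characteristic polynomial of [- M], reversed. *)
Lemma det_addmxZ M (h : R) : h != 0 ->
  \det (1%:M + h *: M) =
  1 + h * (\poly_(i < n) (char_poly (- M))`_(n - i.+1)).[h].
Proof.
move=> h0; set p := char_poly (- M).
have -> : 1%:M + h *: M = h *: (h^-1%:M - - M).
  by rewrite opprK scalerDr scale_scalar_mx divff.
rewrite detZ -horner_char_poly -/p horner_coef size_char_poly big_ord_recr /=.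
(* The monic leading term, multiplied by [h ^+ n], gives the summand 1. *)
have -> : p`_n = 1.
  by have /eqP := char_poly_monic (- M); rewrite lead_coefE size_char_poly.
rewrite mul1r mulrDr exprVn mulfV ?expf_neq0 // addrC; congr (_ + _).
rewrite horner_poly !mulr_sumr (reindex_inj rev_ord_inj) /=.
apply: eq_bigr => i _; rewrite mulrCA [RHS]mulrCA; congr (_ * _).
rewrite -exprS -{1}(subnK (ltn_ord i)) exprD mulrAC -exprMn divff //.
by rewrite expr1n mul1r.
Qed.

(** Factoring out [Q] gives [det (Q + h H) = det Q det (1 + h M)]. For nonzero [h] the difference
    quotient is thus [det Q] times the polynomial [r] at [h], with limit [det Q] times [r.[0]]. *)
Lemma is_derive_det Q H : (0 < n)%N -> Q \in unitmx ->
  is_derive Q H (fun M => \det M) (\det Q * \tr (invmx Q *m H)).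
Proof.
move=> n0 Qu; set M := invmx Q *m H; set p := char_poly (- M).
pose r : {poly R} := \poly_(i < n) p`_(n - i.+1).
(* The constant coefficient of [r] is the coefficient of degree [n - 1] of [p], minus the trace of
   [- M]. *)
have r0 : r.[0] = \tr M.
  rewrite horner_coef0 coef_poly n0 subn1 char_poly_trace //.
  by rewrite raddfN opprK.
have lim : h^-1 *: (((fun M => \det M) \o shift Q) (h *: H) - \det Q)
    @[h --> 0^'] --> (\det Q * \tr M : R).
  have rc : \det Q * r.[h] @[h --> 0^'] --> (\det Q * r.[0] : R).
    apply: cvgM; first exact: cvg_cst.
    by apply: cvg_within_filter; exact: continuous_horner.
  rewrite -r0; apply: cvg_trans rc; apply: near_eq_cvg.
  near=> h; have h0 : h != 0 by near: h; exact: nbhs_dnbhs_neq.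
  rewrite /= -{2 3}[Q]mulmx1.
  have -> : h *: H + Q *m 1%:M = Q *m (1%:M + h *: M).
    by rewrite mulmxDr -scalemxAr mulKVmx // addrC.
  rewrite !det_mulmx det1 det_addmxZ // -/p -/r /GRing.scale /=.
  by field.
by apply: DeriveDef; [apply: cvgP lim | exact: cvg_lim lim].
Unshelve. all: by end_near. Qed.

End Jacobi.

(** * Unit vectors of a positive definite form: pairing and finiteness *)

(** Induction on the size: removing the head [v] and its distinct opposite leaves a list still
    closed under negation. *)
Lemma perm_opp_split (V : zmodType) (s : seq V) : uniq s ->
  {in s, forall v, - v \in s} -> {in s, forall v, - v != v} ->
  exists t, perm_eq s (t ++ map -%R t).
Proof.
have [k] := ubnP (size s); elim: k s => // k IHk [|v s] /= sk.
  by exists [::].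
case/andP=> vs us sN sNv.
have Nvs : - v \in s.
  by have := sN v (mem_head _ _); rewrite inE (negPf (sNv v (mem_head _ _))).
have sub w : w \in rem (- v) s -> [/\ w \in s, w != - v & w != v].
  rewrite mem_rem_uniq // inE => /andP[wNv ws]; split=> //.
  by apply: contraNneq vs => <-.
have [||w /sub[ws wNv wv]|w /sub[ws _ _]|t pt] := IHk (rem (- v) s).
- by rewrite size_rem // (leq_ltn_trans (leq_pred _)).
- exact: rem_uniq.
- rewrite mem_rem_uniq // !inE eqr_opp wv /=.
  have := sN w; rewrite !inE ws orbT => /(_ isT); case: eqP => // wE _.
  by rewrite -wE opprK eqxx in wNv.
- by apply: sNv; rewrite inE ws orbT.
exists (v :: t); rewrite /= perm_cons.
rewrite (perm_trans (perm_to_rem Nvs)) //.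
rewrite -[X in perm_eq _ X]/(t ++ [:: - v] ++ map -%R t).
by rewrite perm_sym perm_catCA perm_cons perm_sym.
Qed.

Section PositiveDefinite.
Variables (R : realType) (n : nat).
Implicit Types (M Q : 'M[R]_n) (v w : 'rV[R]_n).

Lemma posdef_unitmx M : posdef M -> M \in unitmx.
Proof.
move=> [_ Mpos]; rewrite unitmxE unitfE; apply/det0P => -[v v0 vM].
by have := Mpos v v0; rewrite /qform vM mul0mx mxE ltxx.
Qed.

Lemma posdef_qform_ge0 M v : posdef M -> 0 <= qform M v.
Proof.
move=> [_ Mpos]; have [->|v0] := eqVneq v 0; last exact/ltW/Mpos.
by rewrite /qform !mul0mx mxE.
Qed.

Lemma posdef_gram (E : 'M[R]_n) : E \in unitmx -> posdef (gram E).
Proof.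
move=> Eu; split=> [|v v0]; first by rewrite /gram trmx_mul trmxK.
rewrite -dot_gram lt_def dot_ge0 andbT dot_eq0; apply: contraNneq v0 => vE0.
by rewrite -(mulmxK Eu v) vE0 mul0mx.
Qed.

Lemma qformDZ M v w (t : R) : M^T = M ->
  qform M (v + t *: w) =
  qform M v + 2%:R * t * (w *m M *m v^T) 0 0 + t ^+ 2 * qform M w.
Proof.
move=> Msym; have vw : (v *m M *m w^T) 0 0 = (w *m M *m v^T) 0 0.
  by rewrite -[in LHS](trmxK (v *m M *m w^T)) mxE !trmx_mul trmxK Msym mulmxA.
rewrite /qform linearD linearZ /= !mulmxDl !mulmxDr -!scalemxAl -!scalemxAr.
move: vw; move: (v *m M *m v^T) (v *m M *m w^T) (w *m M *m v^T) (w *m M *m w^T).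
by move=> a b c d; rewrite !mxE => ->; ring.
Qed.

(* Nonnegativity of [M] at [v + t w] for [t = 1, -1], where [w] represents
   the i-th coordinate form with respect to [M]. *)
Lemma posdef_coord_le M v i : posdef M -> qform M v = 1 ->
  `|v 0 i| <= 1 + qform M (delta_mx 0 i *m invmx M).
Proof.
move=> Mpd v1; set w := delta_mx 0 i *m invmx M.
have wv : (w *m M *m v^T) 0 0 = v 0 i.
  by rewrite mulmxKV ?posdef_unitmx // -/(dot _ _) dotC dot_delta.
have K0 := posdef_qform_ge0 w Mpd.
have ge t : 0 <= 1 + 2%:R * t * v 0 i + t ^+ 2 * qform M w.
  have := posdef_qform_ge0 (v + t *: w) Mpd.
  by rewrite qformDZ ?v1 ?wv //; case: Mpd.
have := ge 1; have := ge (-1); rewrite sqrrN expr1n mul1r => h1 h2.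
(* The two instances say [2 |v_i| <= 1 + qform M w], whose right-hand side is nonnegative. *)
by rewrite ler_norml; apply/andP; split; lra.
Qed.

End PositiveDefinite.

Lemma finite_int_box (n K : nat) :
  finite_set [set v : 'rV[int]_n | forall i, `|v 0 i| <= K%:Z].
Proof.
pose f (w : 'rV['I_(K + K).+1]_n) : 'rV[int]_n := \row_i ((w 0 i)%:Z - K%:Z).
apply: (@sub_finite_set _ _ (range f)); last exact: finite_image.
move=> v /= vK; exists (\row_i inord (absz (v 0 i + K%:Z))) => //.
apply/rowP => i; rewrite !mxE; have := vK i; rewrite ler_norml => /andP[lo hi].
rewrite inordK; lia.
Qed.

Lemma finite_qform_eq1 (R : realType) (n : nat) (Q : 'M[R]_n) : posdef Q ->
  finite_set [set v : 'rV[int]_n | qform Q (intv R v) = 1].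
Proof.
move=> Qpd; pose q i := 1 + qform Q (delta_mx 0 i *m invmx Q).
have q0 i : 0 <= q i by rewrite addr_ge0 ?posdef_qform_ge0.
(* The sum of the nonnegative [q i] bounds all coordinates at once. *)
apply: sub_finite_set (finite_int_box n (Num.bound (\sum_i q i))).
move=> v /= v1 i.
rewrite -(ler_int R) intr_norm.
have := posdef_coord_le i Qpd v1; rewrite mxE => /le_trans; apply.
apply: le_trans (ltW (archi_boundP (sumr_ge0 _ (fun i _ => q0 i)))).
by rewrite (bigD1 i) //= lerDl sumr_ge0.
Qed.

(** * From minimal immersions to critical points of the determinant *)

Section TorusImmersions.
Variables (R : realType) (n : nat).
Hypothesis n_gt0 : (0 < n)%N.

Lemma intvN (v : 'rV[int]_n) : intv R (- v) = - intv R v.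
Proof. by apply/rowP => i; rewrite !mxE rmorphN. Qed.

Lemma qformN (M : 'M[R]_n) (v : 'rV[R]_n) : qform M (- v) = qform M v.
Proof. by rewrite /qform linearN /= !mulNmx mulmxN opprK. Qed.

(** The rows of [(invmx B)^T] form the basis dual to the rows of [B]. *)
Lemma dual_lattice_mem (L : set 'rV[R]_n) (B : 'M[R]_n) (z : 'rV[int]_n) :
  lattice_basis L B -> dual_lattice L (intv R z *m (invmx B)^T).
Proof.
move=> [Bu ->] _ [y _ <-]; exists (\sum_i z 0 i * y 0 i).
rewrite /dot trmx_mul mulmxA -(mulmxA (intv R z)) -trmx_mul mulmxV // trmx1.
rewrite mulmx1 -/(dot _ _) dotE rmorph_sum; apply: eq_bigr => i _.
by rewrite !mxE rmorphM.
Qed.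

(** The constraint is affine in the matrix, so one nonzero [t] with [Q + t H] in the set kills its
    linear part. *)
Lemma W_tangent_qform (X : set 'rV[int]_n) (Q H : 'M[R]_n) A : W_of X Q ->
  (\forall t \near (0 : R), W_of X (Q + t *: H)) -> X A ->
  qform H (intv R A) = 0.
Proof.
move=> [_ Q1] nearW XA.
have [t [[_ Qt] t0]] : exists t : R, W_of X (Q + t *: H) /\ t != 0.
  apply: (@filter_ex _ (0 : R)^'); near=> t; split.
    by near: t; exact: nbhs_dnbhs.
  by near: t; exact: nbhs_dnbhs_neq.
have := Qt A XA; rewrite /qform mulmxDr mulmxDl -scalemxAr -scalemxAl.
move: (Q1 A XA); rewrite /qform.
move: (intv R A *m Q *m _) (intv R A *m H *m _) => a b aE; rewrite !mxE aE.
move=> /eqP; rewrite -subr_eq0 addrAC subrr add0r mulf_eq0 (negPf t0).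
by move=> /eqP.
Unshelve. all: by end_near. Qed.

(* The derivative of [det] at [Q] is [det Q] times the trace against [invmx Q],
   a combination of the outer products on which the tangent vectors vanish. *)
Lemma critical_det N (X : set 'rV[int]_n) (Q : 'M[R]_n) (c : 'I_N -> R)
    (A : 'I_N -> 'rV[int]_n) : W_of X Q ->
  second_moment c (fun j => intv R (A j)) = n%:R^-1 *: invmx Q ->
  (forall j, c j != 0 -> X (A j) \/ X (- A j)) ->
  critical_on (fun M : 'M[R]_n => \det M) (W_of X) Q.
Proof.
move=> WQ sm cX; split=> // H nearW.
have Qpd : posdef Q by case: WQ.
apply: is_derive_eq (is_derive_det H n_gt0 (posdef_unitmx Qpd)) _.
have n0 : n%:R != 0 :> R by rewrite pnatr_eq0 -lt0n.
have -> : invmx Q = n%:R *: second_moment c (fun j => intv R (A j)).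
  by rewrite sm scalerA divff // scale1r.
rewrite -scalemxAl mxtraceZ mulmx_suml raddf_sum /= big1 ?mulr0 // => j _.
rewrite -scalemxAl mxtraceZ -qform_mxtrace.
have [->|cj0] := eqVneq (c j) 0; first by rewrite expr0n mul0r.
(* If only [- A j] lies in [X], evenness of the quadratic form concludes. *)
case: (cX j cj0) => XA; rewrite ?(W_tangent_qform WQ nearW XA) ?mulr0 //.
by rewrite -qformN -intvN (W_tangent_qform WQ nearW XA) mulr0.
Qed.

(** With [S] the moment of the coordinates and [G = E E^T], the hypothesis [E^T S E = k] gives
    [G S G = k G]; cancel [G] twice. *)
Lemma gram_second_moment N (c : 'I_N -> R) (A : 'I_N -> 'rV[R]_n)
    (E : 'M[R]_n) (k : R) :
  E \in unitmx -> second_moment c (fun j => A j *m E) = k%:M ->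
  second_moment c A = k *: invmx (gram E).
Proof.
move=> Eu; rewrite second_moment_mulmx => sm.
have Qu : gram E \in unitmx by rewrite /gram unitmx_mul unitmx_tr Eu.
apply: (can_inj (mulKmx Qu)); apply: (can_inj (mulmxK Qu)).
rewrite /= -scalemxAr mulmxV // -scalemxAl mul1mx /gram !mulmxA.
by rewrite -(mulmxA E) -(mulmxA E) sm mul_mx_scalar -scalemxAl.
Qed.

Lemma minimal_critical (L : set 'rV[R]_n) (N : nat)
    (x : 'rV[R]_n -> 'rV[R]_(N + N)) (E : 'M[R]_n) (Y : set 'rV[int]_n) :
  (forall u, enorm (x u) = 1) -> homogeneous L x -> isometric x ->
  lattice_basis (dual_lattice L) E -> half_unit_coords (dual_lattice L) E Y ->
  minimal_in_sphere x ->
  critical_on (fun M : 'M[R]_n => \det M) (W_of Y) (gram E).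
Proof.
move=> x1 [P [c [xi [OO c0 xiL xE]]]] iso [Eu LE] [Y1 Y2] xmin.
have {}xE : x = wave P xi c (fun=> 0).
  by apply/funext => u; rewrite xE exp_map_wave.
subst x.
have /choice[A AE] : forall j, exists A : 'rV[int]_n, intv R A *m E = xi j.
  by move=> j; have := xiL j; rewrite LE => -[A _ <-]; exists A.
have WQ : W_of Y (gram E).
  split=> [|B YB]; first exact: posdef_gram.
  by rewrite -dot_gram; apply/enorm1P; case: (Y1 B YB).
apply: (@critical_det N Y _ c A) => // [|j cj0].
  apply: gram_second_moment => //.
  under eq_fun do rewrite AE.
  exact: (isometric_waveP _ _ OO).1 iso.
(* By minimality a frequency with nonzero amplitude has length 1, so [Y] contains its coordinates or
   their opposite. *)
have [|[]|[]] := Y2 (A j); [|by left|by right].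
rewrite AE; split=> //; apply/enorm1P.
exact: (minimal_wave_unit OO n_gt0 x1 iso xmin).
Qed.

(** * Construction of minimal immersions from convex combinations *)

Lemma exists_minimal_immersion N (L : set 'rV[R]_n) (B Q : 'M[R]_n)
    (c : 'I_N -> R) (A : 'I_N -> 'rV[int]_n) :
  lattice_basis L B -> gram B = invmx Q -> Q \in unitmx ->
  (forall j, qform Q (intv R (A j)) = 1) -> \sum_j c j ^+ 2 = 1 ->
  second_moment c (fun j => intv R (A j)) = n%:R^-1 *: invmx Q ->
  exists x : 'rV[R]_n -> 'rV[R]_(N + N),
    [/\ torus_sphere_immersion L x, isometric x & minimal_in_sphere x].
Proof.
move=> LB BQ Qu A1 c1 sm.
have Bu : B \in unitmx by case: LB.
(* Frequencies are taken in the dual basis, whose Gram matrix is the inverse of [gram B], hence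
   [Q]. *)
pose E := (invmx B)^T; pose xi j := intv R (A j) *m E.
have EE : gram E = Q.
  have Gu : gram B \in unitmx by rewrite /gram unitmx_mul unitmx_tr Bu.
  rewrite -[Q]invmxK -BQ; apply: (can_inj (mulKmx Gu)).
  rewrite /= mulmxV // /gram /E trmxK !mulmxA -(mulmxA B).
  by rewrite -trmx_mul mulVmx // trmx1 mulmx1 mulmxV.
have OO : (1%:M : 'M[R]_(N + N)) *m 1%:M^T = 1%:M by rewrite trmx1 mulmx1.
have iso : isometric (wave 1%:M xi c (fun=> 0)).
  apply/isometric_waveP => //.
  rewrite second_moment_mulmx sm -BQ /gram /E trmxK -scalemxAr -scalemxAl.
  rewrite !mulmxA mulVmx // mul1mx -trmx_mul mulVmx //.
  by rewrite trmx1 scalemx1.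
exists (wave 1%:M xi c (fun=> 0)); split=> //.
  split.
  - by move=> u v; apply: wave_periodic => j; apply: dual_lattice_mem.
  - by move=> u; apply/enorm1P; rewrite dot_wave_self.
  - exact: smooth_wave.
  - by move=> u; apply: injective_diff_wave.
by apply: minimal_wave => // j; rewrite dot_gram EE.
Qed.

Lemma qform_eq1_halves (Q : 'M[R]_n) : posdef Q ->
  exists t : seq 'rV[int]_n,
    [set v : 'rV[int]_n | qform Q (intv R v) = 1] #= `I_(size t + size t) /\
    forall v, qform Q (intv R v) = 1 <-> v \in t \/ - v \in t.
Proof.
move=> Qpd; have /finite_fsetP[F FE] := finite_qform_eq1 Qpd.
have FP v : v \in finmap.enum_fset F <-> qform Q (intv R v) = 1.
  by have /(congr1 (fun S => S v)) /= -> := FE.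
have [|v /FP v1|v /FP v1|t pt] := @perm_opp_split _ (finmap.enum_fset F).
- exact: finmap.fset_uniq.
- by apply/FP; rewrite intvN qformN.
(* An integer vector equal to its opposite is 0, where the form takes the value 0, not 1. *)
- apply/eqP => vN; move: v1; have -> : v = 0.
    apply/rowP => i; have /(congr1 (fun w : 'rV[int]_n => w 0 i)) := vN.
    by rewrite !mxE => /eqP; rewrite eqNr => /eqP.
  have -> : intv R (0 : 'rV_n) = 0 by apply/rowP => i; rewrite !mxE.
  by rewrite /qform !mul0mx mxE => /eqP; rewrite eq_sym oner_eq0.
exists t; split.
  by rewrite FE; apply/card_eq_fsetP; rewrite (perm_size pt) size_cat size_map.
have mt v : (v \in finmap.enum_fset F) = (v \in t) || (- v \in t).
  by rewrite (perm_mem pt) mem_cat -{2}[v]opprK (mem_map oppr_inj).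
by move=> v; rewrite -FP mt; split => /orP.
Qed.

(* Opposite vectors have the same outer product, so the weights of the convex
   combination can be collected on the chosen half of the vectors. *)
Lemma convex_hull_second_moment (X : set 'rV[int]_n) (M : 'M[R]_n)
    (t : seq 'rV[int]_n) :
  C_of X M -> (forall v, X v -> v \in t \/ - v \in t) ->
  exists c : 'I_(size t) -> R, \sum_j c j ^+ 2 = 1 /\
    second_moment c (fun j => intv R (tnth (in_tuple t) j)) = M.
Proof.
move=> [m [w [p [pX w0 w1 ->]]]] Xt.
have /choice[f fE] : forall i, exists j : 'I_(size t),
    p i = (intv R (tnth (in_tuple t) j))^T *m intv R (tnth (in_tuple t) j).
  move=> i; have [v Xv <-] := pX i.
  have [/seq_tnthP[j vE]|/seq_tnthP[j vE]] := Xt v Xv; exists j.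
    by rewrite vE.
  by rewrite -[v]opprK vE intvN mulmxN linearN /= mulNmx opprK.
(* The square root, because amplitudes enter the second moment squared. *)
pose c j := Num.sqrt (\sum_(i | f i == j) w i).
have cE j : c j ^+ 2 = \sum_(i | f i == j) w i by rewrite sqr_sqrtr ?sumr_ge0.
exists c; split.
  by rewrite -w1 (partition_big f predT) //=; apply: eq_bigr => j _; rewrite cE.
rewrite (partition_big f predT) //=; apply: eq_bigr => j _.
by rewrite cE scaler_suml; apply: eq_bigr => i /eqP <-; rewrite fE.
Qed.

End TorusImmersions.

Theorem theorem3p2 (R : realType) (n : nat) (n_gt0 : (0 < n)%N) :
  (forall (L : set 'rV[R]_n) (N : nat) (x : 'rV[R]_n -> 'rV[R]_(N + N))
          (E : 'M[R]_n) (Y : set 'rV[int]_n),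
     is_lattice L ->
     unit_vectors (dual_lattice L) #= `I_(N + N) ->
     torus_sphere_immersion L x ->
     homogeneous L x ->
     isometric x ->
     lattice_basis (dual_lattice L) E ->
     half_unit_coords (dual_lattice L) E Y ->
     minimal_in_sphere x ->
     critical_on (fun M : 'M[R]_n => \det M) (W_of Y) (gram E))
  /\
  (forall (X : set 'rV[int]_n) (Q : 'M[R]_n),
     critical_on (fun M : 'M[R]_n => \det M) (W_of X) Q ->
     C_of X (n%:R^-1 *: invmx Q) ->
     exists N : nat,
       [set v : 'rV[int]_n | qform Q (intv R v) = 1] #= `I_(N + N) /\
       forall (L : set 'rV[R]_n) (B : 'M[R]_n),
         lattice_basis L B -> gram B = invmx Q ->
         exists x : 'rV[R]_n -> 'rV[R]_(N + N),
           [/\ torus_sphere_immersion L x, isometric x &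
               minimal_in_sphere x]).
Proof.
split.
  move=> L N x E Y _ _ [_ x1 _ _] xhom xiso LE EY xmin.
  exact: (minimal_critical n_gt0 x1 xhom xiso LE EY xmin).
move=> X Q [[Qpd QX] _] CQ; have [t [tcard tP]] := qform_eq1_halves Qpd.
exists (size t); split=> // L B LB BQ.
have [c [c1 sm]] :=
  (* As [Q] lies in [W_X], every vector of [X] is among the unit vectors of [Q], hence in [t] up to
     sign. *)
  convex_hull_second_moment CQ (fun v Xv => (tP v).1 (QX v Xv)).
apply: exists_minimal_immersion LB BQ (posdef_unitmx Qpd) _ c1 sm => // j.
by apply/tP; left; apply: mem_tnth.
Qed.
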